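(* In a hyperbolic group $G$ every quasiconvex product is a quasiconvex set.
   Context: Let $\mathcal{A}$ be a finite symmetrized generating set of the hyperbolic group $G$ and $\Gamma(G,\mathcal{A})$ the Cayley graph. A subset $Q\subseteq G$ is quasiconvex if there is $\varepsilon\ge 0$ such that every geodesic in $\Gamma(G,\mathcal{A})$ connecting two elements of $Q$ lies in the closed $\varepsilon$-neighborhood of $Q$ (in a hyperbolic group this does not depend on the choice of $\mathcal{A}$). If $G_1,\dots,G_n$ are quasiconvex subgroups of $G$ and $f_1,\dots,f_n\in G$, $n\in\mathbb{N}$, $n\ge1$, then the set $f_1G_1f_2G_2\cdots f_nG_n=\{f_1g_1f_2g_2\cdots f_ng_n \mid g_i\in G_i,\ i=1,\dots,n\}$ is called a quasiconvex product. *)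

(* Defs.v *)
From HB Require Import structures.
From mathcomp Require Import all_boot all_order all_algebra.
From mathcomp Require Import all_classical all_reals.

Set Implicit Arguments.
Unset Strict Implicit.
Unset Printing Implicit Defensive.

Import Order.TTheory GRing.Theory Num.Theory.

Local Open Scope classical_set_scope.
Local Open Scope ring_scope.

(* A is a finite symmetrized generating set (listed as a sequence; order and
   repetitions are irrelevant). *)
Definition sym_gen_set (G : groupType) (A : seq G) : Prop :=
  (forall a, a \in A -> a^-1%g \in A) /\
  (forall g : G, exists2 w : seq G,
     {subset w <= A} & (\prod_(a <- w) a)%g = g).

(* Points of the geometric realization of the Cayley graph of G with respect
   to A: Edge g a t is the point at distance t from g on the unit-length edge
   labelled a from g to g * a.  This is a set of names of points: for instance
   Edge g a 0 and Vertex g name the same point, and so do Edge g a t and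
   Edge (g * a) a^-1 (1 - t), an edge being identified with its inverse.
   Names of the same point are at distance 0 for cayley_dist. *)
Inductive cayley (R : realType) (G : groupType) (A : seq G) : Type :=
| Vertex (g : G)
| Edge (g a : G) (t : R) of a \in A & 0 <= t <= 1.

Arguments Vertex {R G A} g.
Arguments Edge {R G A} g a t _ _.

(* The vertices bounding the cell of p, with the length of the arc of that
   cell going from p to each of them. *)
Definition ends (R : realType) (G : groupType) (A : seq G) (p : cayley R A) :
    seq (G * R) :=
  match p with
  | Vertex g => [:: (g, 0)]
  | Edge g a t _ _ => [:: (g, t); ((g * a)%g, 1 - t)]
  end.

(* Lengths of the arcs joining p to q inside a single edge, traversed by the
   names of p and q either in the same or in opposite directions. *)
Definition edge_arc (R : realType) (G : groupType) (A : seq G)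
    (p q : cayley R A) (l : R) : Prop :=
  match p, q with
  | Edge g a t _ _, Edge h b s _ _ =>
      [/\ h = g, b = a & l = `|t - s|] \/
      [/\ h = (g * a)%g, b = a^-1%g & l = `|t - (1 - s)|]
  | _, _ => False
  end.

(* Lengths of the arcs joining p to q through vertices: from p to a vertex u,
   along the edge path from u to v labelled by a word w, and from v to q. *)
Definition vertex_arc (R : realType) (G : groupType) (A : seq G)
    (p q : cayley R A) (l : R) : Prop :=
  exists (u v : G * R) (w : seq G),
    [/\ u \in ends p, v \in ends q, {subset w <= A},
        (u.1 * \prod_(a <- w) a)%g = v.1 &
        l = u.2 + (size w)%:R + v.2].

(* The path metric; on vertices it is the word metric d(g,h) = |g^-1 h|. *)
Definition cayley_dist (R : realType) (G : groupType) (A : seq G)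
    (p q : cayley R A) : R :=
  inf [set l | edge_arc p q l \/ vertex_arc p q l].

(* c restricted to [0, l] is a geodesic from p to q; endpoints are compared as
   points, not as names. *)
Definition geodesic (R : realType) (G : groupType) (A : seq G)
    (p q : cayley R A) (l : R) (c : R -> cayley R A) : Prop :=
  [/\ 0 <= l, cayley_dist (c 0) p = 0, cayley_dist (c l) q = 0 &
      forall s t, 0 <= s <= l -> 0 <= t <= l ->
        cayley_dist (c s) (c t) = `|s - t|].

(* All geodesic triangles of the Cayley graph (with arbitrary points, not only
   elements of G, as vertices) are delta-slim.  As the sides are oriented
   cyclically, rotating the triangle gives the condition for every side. *)
Definition slim_triangles (R : realType) (G : groupType) (A : seq G)
    (delta : R) : Prop :=
  forall (x y z : cayley R A) (l1 l2 l3 : R) (c1 c2 c3 : R -> cayley R A),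
    geodesic x y l1 c1 -> geodesic y z l2 c2 -> geodesic z x l3 c3 ->
    forall t, 0 <= t <= l1 ->
      (exists2 s, 0 <= s <= l2 & cayley_dist (c1 t) (c2 s) <= delta) \/
      (exists2 s, 0 <= s <= l3 & cayley_dist (c1 t) (c3 s) <= delta).

Definition hyperbolic_group (R : realType) (G : groupType) : Prop :=
  exists2 A : seq G, sym_gen_set A &
    exists2 delta : R, 0 <= delta & slim_triangles A delta.

Definition quasiconvex (R : realType) (G : groupType) (A : seq G)
    (Q : set G) : Prop :=
  exists2 eps : R, 0 <= eps &
    forall (x y : G) (l : R) (c : R -> cayley R A),
      Q x -> Q y -> geodesic (Vertex x) (Vertex y) l c ->
      forall t, 0 <= t <= l ->
        exists2 q : G, Q q & cayley_dist (c t) (Vertex q) <= eps.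

(* Q = f_1 G_1 f_2 G_2 ... f_n G_n with n >= 1 and quasiconvex subgroups G_i;
   the product over i < n is taken in increasing order of i. *)
Definition quasiconvex_product (R : realType) (G : groupType) (A : seq G)
    (Q : set G) : Prop :=
  exists (n : nat) (f : 'I_n -> G) (H : 'I_n -> groupClosed G),
    [/\ (0 < n)%N,
        forall i, quasiconvex R A [set g | g \in H i] &
        Q = [set x | exists2 g : 'I_n -> G, (forall i, g i \in H i) &
               x = (\prod_(i < n) (f i * g i))%g]].

(* Main.v *)
Require Import Defs.
From HB Require Import structures.
From mathcomp Require Import all_boot all_order all_algebra.
From mathcomp Require Import all_classical all_reals.
From mathcomp Require Import zify lra.

Set Implicit Arguments.
Unset Strict Implicit.
Unset Printing Implicit Defensive.

Import Order.TTheory GRing.Theory Num.Theory.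

(** The geometry takes place in the word metric, with values in nat. Geodesics
    are replaced by the intervals they sweep out: [btw d x p y] says that [p]
    lies on some geodesic from [x] to [y], and [thin] is the slim triangle
    condition for intervals.

    If one factor of a product is peeled off, the set has the form [f H S] with
    [H] and [S] quasiconvex. Fix [s0] in [S]. Two of its elements [f h s] and
    [f h' s'] are joined by the chain of points
      [f h s], [f h s0], [f h], [f h'], [f h' s0], [f h' s'].
    A geodesic between two consecutive points of the chain stays at bounded
    distance from [f H S]: the first and the last one because [S] is
    quasiconvex and [f h S], [f h' S] are contained in [f H S]; the second and
    the fourth because their length is that of [s0]; the middle one because it
    is close to [f H], hence to [f H s0]. Thinness closes up the chain
    ([geodesics_near_trans], [word_quasiconvexM]), and an induction on the
    number of factors concludes ([word_quasiconvex_prod]).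

    Thinness is needed for the generating set with respect to which
    quasiconvexity is measured, whereas hyperbolicity provides it for some
    generating set. The two word metrics are bilipschitz
    ([word_length_lipschitz]), so geodesics of one are quasigeodesics of the
    other, and thinness is transported by the stability of quasigeodesics
    ([geodesic_near_quasigeodesic], [quasigeodesic_near_geodesic],
    [thin_bilipschitz]).

    The passage between the geometric realization of the Cayley graph and the
    word metric uses two facts. A geodesic word is realized by a geodesic of
    the graph ([geodesic_word_geodesic]), which turns the hypotheses into
    statements on words. Conversely, every point of an arbitrary geodesic of
    the graph between two group elements [x] and [y] has an end of its cell in
    the interval from [x] to [y] ([geodesic_vertex_near]), which gives the
    conclusion ([quasiconvex_word_quasiconvex]). *)

(** * Thin metrics and stability of quasigeodesics *)

Section GraphMetrics.
Local Open Scope nat_scope.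
Variable T : Type.
Implicit Types (d : T -> T -> nat) (v : nat -> T) (x y z p q : T).

Definition geodesic_seq d v (n : nat) : Prop :=
  forall i j, i <= j <= n -> d (v i) (v j) = j - i.

Definition graph_metric d : Prop :=
  [/\ forall x, d x x = 0, forall x y, d x y = d y x,
      forall x y z, d x z <= d x y + d y z &
      forall x y, exists v,
        [/\ v 0 = x, v (d x y) = y & geodesic_seq d v (d x y)]].

Definition btw d x p y : Prop := d x p + d p y = d x y.

(** The point [q] may lie on any geodesic between the given vertices, instead of
    a prescribed side of the triangle: this makes thinness a condition on the
    metric alone. *)
Definition thin d (delta : nat) : Prop :=
  forall x y z p, btw d x p y ->
    exists2 q, btw d y q z \/ btw d z q x & d p q <= delta.

(** The bounds are purely multiplicative, as they are for the geodesics of a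
    bilipschitz equivalent metric ([geodesic_quasigeodesic]). *)
Definition quasigeodesic_seq d (K : nat) v (n : nat) : Prop :=
  (forall i, i < n -> d (v i) (v i.+1) <= K) /\
  (forall i j, i <= j <= n -> j - i <= K * d (v i) (v j)).

Lemma btw_sym d x p y : graph_metric d -> btw d x p y -> btw d y p x.
Proof. by case=> _ dC _ _; rewrite /btw (dC y p) (dC p x) (dC y x) addnC. Qed.

Lemma geodesic_seq_btw d v n i :
  geodesic_seq d v n -> i <= n -> btw d (v 0) (v i) (v n).
Proof. by move=> gv lin; rewrite /btw !gv ?leqnn ?lin //; lia. Qed.

Lemma geodesic_through d x p y :
  graph_metric d -> btw d x p y ->
  exists v, [/\ v 0 = x, v (d x p) = p, v (d x y) = y &
                geodesic_seq d v (d x y)].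
Proof.
case=> d0 dC dT dG; rewrite /btw => bp.
have [u [u0 up gu]] := dG x p; have [w [w0 wy gw]] := dG p y.
exists (fun i => if i <= d x p then u i else w (i - d x p)).
split; rewrite ?leq0n ?leqnn //.
- case: leqP => h; last by rewrite -[RHS]wy; congr w; lia.
  have e : d p y = 0 by lia.
  by rewrite -[RHS]wy e w0 -[RHS]up; congr u; lia.
- move=> i j /andP[ij jn].
  have [jm|mj] := leqP j (d x p).
    by rewrite (leq_trans ij jm) gu // ij jm.
  have [im|mi] := leqP i (d x p); last by rewrite gw; lia.
  have uip : d (u i) p = d x p - i.
    by have := gu i (d x p) ltac:(lia); rewrite up; lia.
  have xui : d x (u i) = i by have := gu 0 i ltac:(lia); rewrite u0; lia.
  have pwj : d p (w (j - d x p)) = j - d x p.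
    by have := gw 0 (j - d x p) ltac:(lia); rewrite w0; lia.
  have wjy : d (w (j - d x p)) y = d p y - (j - d x p).
    by have := gw (j - d x p) (d p y) ltac:(lia); rewrite wy; lia.
  have := dT (u i) p (w (j - d x p)).
  have := dT x (u i) y; have := dT (u i) (w (j - d x p)) y.
  lia.
Qed.

(** Bisection: thinness applied to the ends and the midpoint of the sequence
    moves [p] by at most [delta] to an interval spanned by half of it, and
    [k] halvings leave at most one step. *)
Lemma geodesic_near_short_path d delta K k v n p :
  graph_metric d -> thin d delta -> n <= 2 ^ k ->
  (forall i, i < n -> d (v i) (v i.+1) <= K) -> btw d (v 0) p (v n) ->
  exists2 i, i <= n & d p (v i) <= delta * k + K.
Proof.
move=> gd thd; have [d0 dC dT _] := gd.
elim: k v n p => [|k IHk] v n p nk vK bp.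
  exists 0 => //; rewrite (dC p).
  move: bp; rewrite /btw.
  case: n nk vK => [|[|//]] _ vK; first by rewrite d0; lia.
  by have := vK 0 isT; lia.
have [q bq pq] := thd _ _ (v n./2) _ bp.
have hn : n./2 <= n by rewrite -divn2 leq_div.
rewrite expnS in nk.
case: bq => [/(btw_sym gd) bq|/(btw_sym gd) bq].
- have [|||i ilt hi] := IHk (fun i => v (n./2 + i)) (n - n./2) q; last 1 first.
  + by exists (n./2 + i); [lia|have := dT p q (v (n./2 + i)); lia].
  + lia.
  + by move=> i hi; rewrite addnS; apply: vK; lia.
  + by rewrite /= addn0 subnKC.
- have [|||i ilt hi] := IHk v n./2 q; last 1 first.
  + by exists i; [lia|have := dT p q (v i); lia].
  + lia.
  + by move=> i hi; apply: vK; lia.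
  + by [].
Qed.

Lemma exp2_dominates a b : exists B, forall j, B <= j -> a + b * j <= 2 ^ j.
Proof.
exists (2 * (a + 2 * b + 1)) => j hj.
set h := j./2.
have e2 : h.*2 <= j <= h.*2.+1 by rewrite /h; lia.
have hh : h < 2 ^ h by apply: ltn_expl.
have : 2 ^ h * 2 ^ h <= 2 ^ j by rewrite -expnD leq_exp2l // addnn; lia.
have : h.+1 * h.+1 <= 2 ^ h * 2 ^ h by apply: leq_mul.
have : a + 2 * b + 1 <= h by lia.
move=> h1 h2 h3; nia.
Qed.

(** Solves the inequality to which the stability argument leads: a quantity
    that is at most an affine function of its own logarithm is bounded. *)
Lemma log_bound a b c : exists D, forall m,
  m <= a + b * up_log 2 (c * m) -> m <= D.
Proof.
have [B hB] := exp2_dominates (c * (a + b)) (c * b).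
exists (a + b * B.+1) => m hm; apply: (leq_trans hm).
rewrite leq_add2l leq_mul2l; apply/orP; right.
set k := up_log 2 (c * m) in hm *.
rewrite leqNgt; apply/negP => kB.
have c1 : 1 < c * m.
  by have := up_log_gt0 2 (c * m); rewrite -/k (leq_ltn_trans (leq0n _) kB).
have kc : 2 ^ k.-1 < c * m by apply: up_log_gtn.
clearbody k; case: k hm kB kc => [//|j] hm kB kc.
have := hB j ltac:(lia).
have : c * m <= c * (a + b * j.+1) by rewrite leq_mul2l hm orbT.
rewrite /= in kc *; nia.
Qed.

(** One side of the detour around [p]. When every point of the interval is
    [D]-close to the sequence but [p] is [D]-far from it, go back from [p]
    towards [x] by [2 * D], or up to [x] itself, and from there cross over to
    the sequence: the crossing has length at most [D], or 0, so it keeps a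
    distance of at least [D] from [p]. *)
Lemma detour_start d v n D x y p :
  graph_metric d -> btw d x p y -> (exists2 i, i <= n & v i = x) ->
  (forall q, btw d x q y -> exists2 i, i <= n & d q (v i) <= D) ->
  (forall i, i <= n -> D <= d p (v i)) ->
  exists a, exists2 i, i <= n & [/\ btw d x a p, d a p <= 2 * D,
    d a (v i) <= D & forall q, btw d a q (v i) -> D <= d p q].
Proof.
move=> gd bp [i0 i0n vx] near far; have [d0 dC dT _] := gd.
have [small|large] := leqP (d x p) (2 * D).
  exists x; exists i0 => //; split=> //; rewrite ?vx ?d0 /btw ?d0 //.
  move=> q h; have := far _ i0n; have := dT p q x.
  by rewrite vx; lia.
have [v' [v'0 v'p v'y gv]] := geodesic_through gd bp.
have pxy : d x p <= d x y by move: bp; rewrite /btw; lia.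
pose a := v' (d x p - 2 * D).
have da : d a p = 2 * D.
  by have := gv (d x p - 2 * D) (d x p) ltac:(lia); rewrite v'p -/a; lia.
have xa : d x a = d x p - 2 * D.
  by have := gv 0 (d x p - 2 * D) ltac:(lia); rewrite v'0 -/a; lia.
have ay : d a y = d x y - d x a.
  by have := gv (d x p - 2 * D) (d x y) ltac:(lia); rewrite v'y -/a; lia.
have [|i ilt hi] := near a; first by rewrite /btw; lia.
exists a; exists i => //; split; rewrite /btw //; try lia.
by move=> q bq; have := dT p q a; rewrite (dC q a) (dC p a); lia.
Qed.

(** Let [q] be a point of the interval at maximal distance [M] from the
    sequence. Two detours starting on either side of [q] reach the sequence at
    [v i] and [v j], which are [6 * M]-close, so that the part of the sequence
    between them has length linear in [M]. Thinness of the quadrilateral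
    formed by the crossings puts [q] near a crossing, which bounds [M]
    at once, or near the interval from [v i] to [v j], hence at distance
    logarithmic in [M] from the sequence. *)
Lemma geodesic_near_quasigeodesic d delta K :
  graph_metric d -> thin d delta -> exists D, forall v n p,
    quasigeodesic_seq d K v n -> btw d (v 0) p (v n) ->
    exists2 i, i <= n & d p (v i) <= D.
Proof.
move=> gd thd; have [d0 dC dT _] := gd.
have [D hD] := log_bound (2 * delta + K) delta (6 * K).
exists D => v n p qv bp.
(* [P m]: some point of the interval is at distance at least [m] from the
   sequence; its largest value is attained at [q] *)
pose P m := `[< exists2 q, btw d (v 0) q (v n) &
                  forall i, i <= n -> m <= d q (v i) >].
have exP : exists m, P m by exists 0; apply/asboolP; exists p.
have ubP m : P m -> m <= d (v 0) (v n).
  move=> /asboolP[q bq far]; move: bq (far 0 (leq0n _)).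
  by rewrite /btw (dC q (v 0)); lia.
have [M /asboolP[q bq far] maxM] := ex_maxnP exP ubP.
have near r : btw d (v 0) r (v n) -> exists2 i, i <= n & d r (v i) <= M.
  move=> br; apply: contrapT => no.
  suff /maxM : P M.+1 by rewrite ltnn.
  apply/asboolP; exists r => // i ilt; rewrite ltnNge; apply/negP => h.
  by apply: no; exists i.
suff MD : M <= D.
  by have [i ilt hi] := near _ bp; exists i => //; lia.
apply: hD.
have [|a [i ilt [xa ap avi far_a]]] := detour_start gd bq _ near far.
  by exists 0.
have [||b [j jlt [yb bp' bvj far_b]]] :=
    detour_start gd (btw_sym gd bq) _ _ far.
- by exists n.
- by move=> r /(btw_sym gd); apply: near.
have bab : btw d a q b.
  move: xa yb bq; rewrite /btw (dC (v n)) (dC b q) (dC (v n) q) => xa yb bq.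
  have := dT a q b; have := dT (v 0) a (v n); have := dT a b (v n).
  rewrite (dC b q) in bp' *; lia.
have [q1 bq1 qq1] := thd _ _ (v j) _ bab.
case: bq1 => [/far_b|bq1]; first lia.
have [q2 bq2 qq2] := thd _ _ (v i) _ bq1.
case: bq2 => [/far_a|bq2]; first by have := dT q q1 q2; lia.
have vij : d (v i) (v j) <= 6 * M.
  have := dT (v i) a (v j); have := dT a b (v j); have := dT a q b.
  by rewrite (dC (v i) a) (dC q b); lia.
have qq : d q q2 <= 2 * delta by have := dT q q1 q2; lia.
have key i' j' : i' <= j' <= n -> d (v i') (v j') <= 6 * M ->
    btw d (v i') q2 (v j') ->
    M <= 2 * delta + K + delta * up_log 2 (6 * K * M).
  move=> ij dij b2; have [vK vq] := qv.
  have [|||k kle hk] := @geodesic_near_short_path d delta K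
    (up_log 2 (6 * K * M)) (fun k => v (i' + k)) (j' - i') q2 gd thd.
  - apply: leq_trans (up_logP _ _) => //.
    by apply: leq_trans (vq _ _ ij) _; nia.
  - by move=> k hk; rewrite addnS; apply: vK; lia.
  - by rewrite /= addn0 subnKC //; case/andP: ij.
  - have := far (i' + k) ltac:(lia); have := dT q q2 (v (i' + k)); lia.
have [ij|ji] := leqP i j.
  by apply: (key i j) => //; rewrite ij.
by apply: (key j i) => //; [rewrite (ltnW ji)|rewrite dC|apply: btw_sym].
Qed.

(** Follow a geodesic [u] between the end points. Each of its points is close
    to the sequence, at its start to [v 0] and at its end to [v n]; where the
    close index first passes [m], one point of [u] is close both to some [v i]
    with [i <= m] and to some [v j] with [m <= j]. Then [j - i] is bounded and
    [v m], which lies in between, is close to that point too. *)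
Lemma quasigeodesic_near_geodesic d delta K :
  graph_metric d -> thin d delta -> exists D, forall v n m,
    quasigeodesic_seq d K v n -> m <= n ->
    exists2 p, btw d (v 0) p (v n) & d (v m) p <= D.
Proof.
move=> gd thd; have [d0 dC dT dG] := gd.
have [D hD] := geodesic_near_quasigeodesic K gd thd.
exists (K * (K * (2 * D + 1)) + D) => v n m qv mn.
have [u [u0 un gu]] := dG (v 0) (v n); set L := d _ _ in un gu.
pose P k := `[< k <= L /\ exists2 i, m <= i <= n & d (u k) (v i) <= D >].
have exP : exists k, P k.
  exists L; apply/asboolP; split=> //; exists n; rewrite ?mn ?leqnn //.
  by rewrite un d0.
have [k /asboolP[kL [j /andP[mj jn] hj]] mink] := ex_minnP exP.
have [i im hi] : exists2 i, i <= m & d (u k) (v i) <= D.+1.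
  case: k => [|k] in kL hj mink *; first by exists 0; rewrite ?u0 ?d0.
  have [|i ilt hi] := hD v n (u k) qv.
    by rewrite -{1}u0 -un; apply: geodesic_seq_btw; [exact: gu|lia].
  exists i; last first.
    have := dT (u k.+1) (u k) (v i); have := gu k k.+1.
    by rewrite (dC (u k.+1) (u k)); lia.
  rewrite leqNgt; apply/negP => mi.
  have /mink : P k; last by rewrite ltnn.
  by apply/asboolP; split; [lia|exists i => //; rewrite (ltnW mi)].
exists (u k); first by rewrite -{1}u0 -un; apply: geodesic_seq_btw.
have [vK vq] := qv.
have vij : d (v i) (v j) <= 2 * D + 1.
  by have := dT (v i) (u k) (v j); rewrite (dC (v i) (u k)); lia.
have hji : j - i <= K * (2 * D + 1).
  by apply: leq_trans (vq i j _) _; [lia|rewrite leq_mul2l vij orbT].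
have steps a b : a + b <= n -> d (v a) (v (a + b)) <= K * b.
  elim: b => [|b IH] ab; first by rewrite addn0 d0.
  rewrite addnS mulnS.
  have := dT (v a) (v (a + b)) (v (a + b).+1); have := vK (a + b) ltac:(lia).
  by have := IH ltac:(lia); lia.
have := steps m (j - m) ltac:(lia); rewrite subnKC // => vmj.
have := dT (v m) (v j) (u k); rewrite (dC (v j) (u k)).
have : K * (j - m) <= K * (K * (2 * D + 1)) by rewrite leq_mul2l; lia.
lia.
Qed.

Lemma geodesic_quasigeodesic d d' K v n :
  (forall x y, d x y <= K * d' x y) -> (forall x y, d' x y <= K * d x y) ->
  geodesic_seq d' v n -> quasigeodesic_seq d K v n.
Proof.
move=> dd' d'd gv; split=> [i ilt|i j ij].
  by have := dd' (v i) (v i.+1); rewrite gv; lia.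
by rewrite -gv.
Qed.

(** The given point is moved from its [d']-geodesic to a [d]-interval, across a
    thin [d]-triangle, and back to a [d']-geodesic side. *)
Lemma thin_bilipschitz d d' K delta :
  graph_metric d -> graph_metric d' ->
  (forall x y, d x y <= K * d' x y) -> (forall x y, d' x y <= K * d x y) ->
  thin d delta -> exists delta', thin d' delta'.
Proof.
move=> gd gd' dd' d'd thd; have [d0 dC dT dG] := gd.
have [D1 hD1] := quasigeodesic_near_geodesic K gd thd.
have [D2 hD2] := geodesic_near_quasigeodesic K gd thd.
exists (K * (D1 + delta + D2)) => x y z p bp.
have qg := geodesic_quasigeodesic dd' d'd.
have [v [v0 vp vn gv]] := geodesic_through gd' bp.
have pxy : d' x p <= d' x y by move: bp; rewrite /btw; lia.
have [p' bp' pp'] := hD1 _ _ _ (qg _ _ gv) pxy.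
rewrite v0 vn vp in bp' pp'.
have [q' bq' p'q'] := thd _ _ z _ bp'.
have back a b : btw d a q' b ->
    exists2 q, btw d' a q b & d' p q <= K * (D1 + delta + D2).
  move=> bq; have [_ _ _ /(_ a b)[u [u0 un gu]]] := gd'.
  have [|i ilt hi] := hD2 _ _ q' (qg _ _ gu); first by rewrite u0 un.
  exists (u i); first by rewrite -{1}u0 -un; apply: geodesic_seq_btw.
  apply: leq_trans (d'd _ _) _; rewrite leq_mul2l; apply/orP; right.
  by have := dT p p' (u i); have := dT p' q' (u i); lia.
by case: bq' => /back[q bq pq]; exists q => //; [left|right].
Qed.

(** Unlike quasiconvexity of [P], this makes sense for end points outside [P],
    such as the intermediate points of the chain for a product. *)
Definition geodesics_near d (P : T -> Prop) (N : nat) x y : Prop :=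
  forall p, btw d x p y -> exists2 q, P q & d p q <= N.

Lemma geodesics_near_trans d delta P N N' x y z :
  graph_metric d -> thin d delta ->
  geodesics_near d P N x y -> geodesics_near d P N' y z ->
  geodesics_near d P (delta + N + N') x z.
Proof.
move=> gd thd nxy nyz p bp; have [_ dC dT _] := gd.
have [q bq pq] := thd _ _ y _ bp.
case: bq => /(btw_sym gd); [move=> /nyz|move=> /nxy] => -[r Pr qr];
  by exists r => //; have := dT p q r; lia.
Qed.
End GraphMetrics.

(** * The word metric *)

Section WordMetric.
Local Open Scope nat_scope.
Variables (G : groupType) (A : seq G).
Implicit Types (g h x y : G) (w : seq G).

Definition has_word g (n : nat) : Prop :=
  exists w, [/\ {subset w <= A}, (\prod_(a <- w) a)%g = g & size w = n].

Definition word_length g : nat :=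
  get [set n | has_word g n /\ forall m, has_word g m -> n <= m]%classic.

Definition word_dist g h : nat := word_length (g^-1 * h)%g.

Hypothesis hA : sym_gen_set A.

Lemma word_lengthP g :
  has_word g (word_length g) /\ forall m, has_word g m -> word_length g <= m.
Proof.
apply: (@getPex _
  [set n | has_word g n /\ forall m, has_word g m -> n <= m]%classic).
have ex : exists n, `[< has_word g n >].
  have [w sw wg] := hA.2 g.
  by exists (size w); apply/asboolP; exists w.
case: (ex_minnP ex) => n /asboolP hn min; exists n; split=> // m hm.
by apply: min; apply/asboolP.
Qed.

Lemma word_length_le w :
  {subset w <= A} -> word_length (\prod_(a <- w) a)%g <= size w.
Proof. by move=> sw; apply: (word_lengthP _).2; exists w. Qed.

Lemma word_length1 : word_length 1%g = 0.
Proof.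
apply/eqP; rewrite -leqn0; apply: (word_lengthP _).2.
by exists [::]; split=> //; rewrite big_nil.
Qed.

Lemma word_lengthM g h : word_length (g * h)%g <= word_length g + word_length h.
Proof.
have [[w [sw <- <-]] _] := word_lengthP g.
have [[w' [sw' <- <-]] _] := word_lengthP h.
rewrite -big_cat -size_cat; apply: word_length_le => a.
by rewrite mem_cat => /orP[/sw|/sw'].
Qed.

Lemma word_lengthV_le g : word_length g^-1%g <= word_length g.
Proof.
have [[w [sw <- <-]] _] := word_lengthP g.
rewrite -[X in (\prod_(a <- X) a)^-1%g]revK -prodgV.
rewrite -(big_map (fun a : G => a^-1%g) xpredT id).
rewrite -(size_rev w) -(size_map (fun a : G => a^-1%g)).
apply: word_length_le => a /mapP[b bw ->]; apply: hA.1; apply: sw.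
by rewrite mem_rev in bw.
Qed.

Lemma word_lengthV g : word_length g^-1%g = word_length g.
Proof.
by apply/eqP; rewrite eqn_leq word_lengthV_le -{1}(invgK g) word_lengthV_le.
Qed.

Lemma word_distMl f g h : word_dist (f * g)%g (f * h)%g = word_dist g h.
Proof. by rewrite /word_dist invgM -mulgA mulKg. Qed.

Lemma word_dist_mulr g h : word_dist g (g * h)%g = word_length h.
Proof. by rewrite /word_dist mulKg. Qed.

Lemma word_dist0 g : word_dist g g = 0.
Proof. by rewrite /word_dist mulVg word_length1. Qed.

Lemma word_distC g h : word_dist g h = word_dist h g.
Proof. by rewrite /word_dist -word_lengthV invgM invgK. Qed.

Lemma word_dist_triangle f g h :
  word_dist f h <= word_dist f g + word_dist g h.
Proof.
rewrite /word_dist; have -> : (f^-1 * h = (f^-1 * g) * (g^-1 * h))%g.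
  by rewrite -mulgA mulVKg.
exact: word_lengthM.
Qed.

Definition geodesic_word w : Prop :=
  {subset w <= A} /\ word_length (\prod_(a <- w) a)%g = size w.

Definition path_vertex g w i : G := (g * \prod_(a <- take i w) a)%g.

Lemma path_vertex0 g w : path_vertex g w 0 = g.
Proof. by rewrite /path_vertex take0 big_nil mulg1. Qed.

Lemma path_vertexS g w i :
  i < size w -> path_vertex g w i.+1 = (path_vertex g w i * nth 1%g w i)%g.
Proof.
move=> iw; rewrite /path_vertex (take_nth 1%g) //.
by rewrite -cats1 big_cat big_seq1 mulgA.
Qed.

Lemma path_vertex_size g w :
  path_vertex g w (size w) = (g * \prod_(a <- w) a)%g.
Proof. by rewrite /path_vertex take_size. Qed.

Lemma geodesic_path_vertex g w :
  geodesic_word w -> geodesic_seq word_dist (path_vertex g w) (size w).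
Proof.
case=> sw lw.
have le i j : i <= j <= size w ->
    word_dist (path_vertex g w i) (path_vertex g w j) <= j - i.
  case/andP=> ij jw; rewrite /path_vertex word_distMl.
  rewrite -[in take j w](subnKC ij) takeD big_cat word_dist_mulr.
  apply: leq_trans (word_length_le _) _.
    by move=> a /mem_take /mem_drop /sw.
  by rewrite size_take; case: ifP => //; lia.
move=> i j ijw; apply/eqP; rewrite eqn_leq le //=.
have := le 0 i ltac:(lia); have := le j (size w) ltac:(lia).
have := word_dist_triangle (path_vertex g w 0) (path_vertex g w i)
  (path_vertex g w (size w)).
have := word_dist_triangle (path_vertex g w i) (path_vertex g w j)
  (path_vertex g w (size w)).
rewrite path_vertex0 path_vertex_size word_dist_mulr lw; lia.
Qed.

Lemma geodesic_word_between x y :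
  exists2 w, geodesic_word w & (x * \prod_(a <- w) a)%g = y.
Proof.
have [[w [sw wg sz]] _] := word_lengthP (x^-1 * y)%g.
by exists w; [split=> //; rewrite wg sz|rewrite wg mulVKg].
Qed.

Lemma word_dist_graph_metric : graph_metric word_dist.
Proof.
split; [exact: word_dist0|exact: word_distC| | ].
  by move=> x y z; exact: word_dist_triangle.
move=> x y; have [w gw <-] := geodesic_word_between x y.
rewrite word_dist_mulr gw.2.
exists (path_vertex x w); rewrite path_vertex0 path_vertex_size.
by split=> //; exact: geodesic_path_vertex.
Qed.

(** The concatenation of geodesic words from [x] to [p] and from [p] to [y] is
    geodesic. *)
Lemma btw_geodesic_word x p y : btw word_dist x p y ->
  exists w, [/\ geodesic_word w, path_vertex x w (size w) = y,
    word_dist x p <= size w & path_vertex x w (word_dist x p) = p].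
Proof.
move=> bp; have [w [sw lw]] := geodesic_word_between x p => ep.
have [w' [sw' lw']] := geodesic_word_between p y => ey.
have e1 : word_dist x p = size w by rewrite -ep word_dist_mulr.
have e2 : word_dist p y = size w' by rewrite -ey word_dist_mulr.
have prod : (x * \prod_(a <- w ++ w') a)%g = y by rewrite big_cat mulgA ep.
exists (w ++ w'); split.
- split=> [a|]; first by rewrite mem_cat => /orP[/sw|/sw'].
  by rewrite -(word_dist_mulr x) prod size_cat -e1 -e2.
- by rewrite path_vertex_size.
- by rewrite size_cat e1 leq_addr.
- by rewrite /path_vertex e1 take_size_cat.
Qed.

End WordMetric.

Lemma word_length_lipschitz (G : groupType) (A B : seq G) :
  sym_gen_set A -> sym_gen_set B ->
  exists K, forall g, (word_length B g <= K * word_length A g)%N.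
Proof.
move=> hA hB; exists (\sum_(a <- A) word_length B a)%N => g.
have [[w [sw <- <-]] _] := word_lengthP hA g.
elim: w sw => [|a w IH] sw; first by rewrite big_nil word_length1.
rewrite big_cons /= mulnS; apply: leq_trans (word_lengthM hB _ _) _.
apply: leq_add; last by apply: IH => b bw; apply: sw; rewrite inE bw orbT.
have aA : a \in A by apply: sw; rewrite inE eqxx.
by rewrite (perm_big _ (perm_to_rem aA)) big_cons leq_addr.
Qed.

(** * Products of quasiconvex sets *)

Section QuasiconvexSets.
Local Open Scope nat_scope.
Variables (G : groupType) (A : seq G) (delta : nat).
Hypotheses (hA : sym_gen_set A) (thinA : thin (word_dist A) delta).

Definition word_quasiconvex (S : set G) (N : nat) : Prop :=
  forall x y, S x -> S y -> geodesics_near (word_dist A) S N x y.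

Lemma geodesics_near_mull (P : set G) N g x y :
  geodesics_near (word_dist A) P N x y ->
  geodesics_near (word_dist A) [set (g * q)%g | q in P]%classic N
    (g * x)%g (g * y)%g.
Proof.
move=> near p; rewrite -(mulVKg g p) /btw !word_distMl => /near[q Pq pq].
by exists (g * q)%g; [exists q|rewrite word_distMl].
Qed.

Lemma geodesics_near_bounded (P : set G) N x y : P x \/ P y ->
  word_dist A x y <= N -> geodesics_near (word_dist A) P N x y.
Proof.
move=> Pxy xyN p; rewrite /btw => bp.
have := word_distC hA p x.
by case: Pxy => ?; [exists x => //|exists y => //]; lia.
Qed.

(** The chain [f h s], [f h s0], [f h], [f h'], [f h' s0], [f h' s'] described
    at the beginning. *)
Lemma word_quasiconvexM (f : G) (H S : set G) (N N' : nat) :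
  word_quasiconvex H N -> word_quasiconvex S N' ->
  exists M, word_quasiconvex
    [set (f * h * s)%g | h in H & s in S]%classic M.
Proof.
move=> qcH qcS.
have [[s0 Ss0]|noS] := pselect (exists s, S s); last first.
  by exists 0 => x y [h _ [s Ss _]]; case: noS; exists s.
have gd := word_dist_graph_metric hA.
set P := [set _ | _ in _ & _ in _]%classic; set L := word_length A s0.
have near_S h s s' : H h -> S s -> S s' ->
    geodesics_near (word_dist A) P N' (f * h * s)%g (f * h * s')%g.
  move=> Hh Ss Ss' p bp.
  have [_ [q Sq <-] pq] := geodesics_near_mull (g := (f * h)%g)
    (qcS _ _ Ss Ss') bp.
  by exists (f * h * q)%g => //; exists h => //; exists q.
have near_s0 h : H h ->
    geodesics_near (word_dist A) P L (f * h * s0)%g (f * h)%g.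
  move=> Hh; apply: geodesics_near_bounded.
    by left; exists h => //; exists s0.
  by rewrite word_distC // word_dist_mulr.
have near_H h h' : H h -> H h' ->
    geodesics_near (word_dist A) P (N + L) (f * h)%g (f * h')%g.
  move=> Hh Hh' p bp.
  have [_ [q Hq <-] pq] := geodesics_near_mull (qcH _ _ Hh Hh') bp.
  exists (f * q * s0)%g; first by exists q => //; exists s0.
  apply: leq_trans (word_dist_triangle hA _ (f * q)%g _) _.
  by rewrite word_dist_mulr leq_add2r.
eexists => x y [h Hh [s Ss <-]] [h' Hh' [s' Ss' <-]].
apply: (geodesics_near_trans gd thinA (near_S _ _ _ Hh Ss Ss0)).
apply: (geodesics_near_trans gd thinA (near_s0 _ Hh)).
apply: (geodesics_near_trans gd thinA (near_H _ _ Hh Hh')).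
apply: (geodesics_near_trans gd thinA _ (near_S _ _ _ Hh' Ss0 Ss')).
apply: geodesics_near_bounded; last by rewrite word_dist_mulr.
by right; exists h' => //; exists s0.
Qed.

Lemma word_quasiconvex_prod n (f : 'I_n -> G) (H : 'I_n -> set G) :
  (forall i, exists N, word_quasiconvex (H i) N) ->
  exists N, word_quasiconvex
    [set x | exists2 g : 'I_n -> G, (forall i, H i (g i)) &
             x = (\prod_(i < n) (f i * g i))%g]%classic N.
Proof.
elim: n f H => [|n IH] f H qcH.
  exists 0 => x y [g hg ->] [g' hg' ->]; rewrite !big_ord0.
  apply: geodesics_near_bounded; last by rewrite word_dist0.
  by left; exists g => //; rewrite big_ord0.
have [N' qcS] := IH (fun i => f (lift ord0 i)) (fun i => H (lift ord0 i))
  (fun i => qcH (lift ord0 i)).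
have [N qc0] := qcH ord0.
have [M qcM] := word_quasiconvexM (f ord0) qc0 qcS; exists M.
set Q := (X in word_quasiconvex X _) in qcM.
set Q' := (X in word_quasiconvex X _); suff -> : Q' = Q by [].
apply/seteqP; split=> x.
- case=> g hg ->; rewrite big_ord_recl; exists (g ord0); first exact: hg.
  exists (\prod_(i < n) (f (lift ord0 i) * g (lift ord0 i)))%g => //.
  by exists (fun i => g (lift ord0 i)) => // i; exact: hg.
- case=> h Hh [_ [g hg ->] <-].
  exists (fun i => if unlift ord0 i is Some j then g j else h).
    by move=> i; case: unliftP => [j|] -> //; exact: hg.
  rewrite big_ord_recl unlift_none; congr (_ * _)%g.
  by apply: eq_bigr => i _; rewrite liftK.
Qed.

End QuasiconvexSets.

(** * The geometric realization of the Cayley graph *)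

Section CayleyArcs.
Local Open Scope ring_scope.
Variables (R : realType) (G : groupType) (A : seq G).
Hypothesis hA : sym_gen_set A.
Implicit Types (p q : cayley R A) (g x y : G) (u v : G * R).

Definition arc p q (l : R) : Prop := edge_arc p q l \/ vertex_arc p q l.

Lemma ends_ge0 p u : u \in ends p -> 0 <= u.2.
Proof.
case: p => [g|g a t aA /andP[t0 t1]] /=; rewrite !inE.
  by move=> /eqP ->.
by case/orP => /eqP -> //=; rewrite subr_ge0.
Qed.

Lemma ends_vertex p : exists u, u \in ends p.
Proof.
by case: p => [g|g a t aA ht]; [exists (g, 0)|exists (g, t)];
  rewrite /= inE eqxx.
Qed.

Lemma word_dist_letter g (a : G) : a \in A -> (word_dist A g (g * a)%g <= 1)%N.
Proof.
move=> aA; rewrite word_dist_mulr.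
have := @word_length_le _ _ hA [:: a]; rewrite big_seq1; apply.
by move=> b; rewrite inE => /eqP ->.
Qed.

Lemma ends_dist p u v : u \in ends p -> v \in ends p ->
  (word_dist A u.1 v.1)%:R <= u.2 + v.2.
Proof.
case: p => [g|g a t aA /andP[t0 t1]] /=; rewrite !inE.
  by move=> /eqP -> /eqP ->; rewrite word_dist0 //= addr0.
have d1 : (word_dist A g (g * a)%g)%:R <= 1 :> R.
  by rewrite (ler_nat R _ 1) word_dist_letter.
case/orP => /eqP -> /orP[] /eqP -> /=; rewrite ?word_dist0 //.
- lra.
- lra.
- by rewrite word_distC //; lra.
- lra.
Qed.

Lemma vertex_arc_ends p q u v : u \in ends p -> v \in ends q ->
  arc p q (u.2 + (word_dist A u.1 v.1)%:R + v.2).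
Proof.
move=> up vq; right; have [w [sw lw] e] := geodesic_word_between hA u.1 v.1.
by exists u, v, w; split=> //; rewrite -e word_dist_mulr lw.
Qed.

Lemma vertex_arcP p q l : vertex_arc p q l -> exists u v,
  [/\ u \in ends p, v \in ends q &
      u.2 + (word_dist A u.1 v.1)%:R + v.2 <= l].
Proof.
case=> u [v [w [up vq sw e ->]]]; exists u, v; split=> //.
rewrite lerD2r lerD2l ler_nat -e word_dist_mulr; exact: word_length_le.
Qed.

Lemma arc_ge0 p q l : arc p q l -> 0 <= l.
Proof.
case=> [|/vertex_arcP[u [v [up vq]]]].
  case: p q => [//|g a t aA ht] [//|h b s bA hs] /=.
  by case=> -[_ _ ->].
by apply: le_trans; rewrite !addr_ge0 ?(ends_ge0 up) ?(ends_ge0 vq).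
Qed.

Lemma cayley_dist_le p q l : arc p q l -> cayley_dist p q <= l.
Proof.
by move=> pql; apply: ge_inf => //; exists 0 => r; exact: arc_ge0.
Qed.

Lemma le_cayley_dist p q l :
  (forall r, arc p q r -> l <= r) -> l <= cayley_dist p q.
Proof.
move=> le; apply: lb_le_inf => //.
have [u up] := ends_vertex p; have [v vq] := ends_vertex q.
by eexists; exact: vertex_arc_ends up vq.
Qed.

Lemma cayley_dist_lt p q e :
  cayley_dist p q < e -> exists2 l, l < e & arc p q l.
Proof.
move=> lte; apply: contrapT => no; move: lte; rewrite ltNge => /negP; apply.
apply: le_cayley_dist => l pql; rewrite leNgt; apply/negP => le.
by apply: no; exists l.
Qed.

Lemma arcC p q l : arc p q l -> arc q p l.
Proof.
case=> [|/[dup] h].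
  case: p q => [//|g a t aA ht] [//|h b s bA hs] /= [] [e1 e2 ->]; left.
    by left; split=> //; rewrite distrC.
  right; split; rewrite ?e1 ?e2 ?mulgK ?invgK //.
  by congr `|_|; lra.
case=> u [v [w [up vq sw e ->]]]; right.
exists v, u, (rev (map (fun a => a^-1)%g w)).
split=> //.
- move=> a; rewrite mem_rev => /mapP[b bw ->]; apply: hA.1; exact: sw.
- rewrite -e -map_rev big_map prodgV revK mulgK //.
- by rewrite size_rev size_map; lra.
Qed.

Lemma cayley_distC p q : cayley_dist p q = cayley_dist q p.
Proof.
by apply/le_anti/andP; split; apply: le_cayley_dist => l /arcC;
  exact: cayley_dist_le.
Qed.

(** An arc within an edge can be prolonged to an end of that edge, and a route
    through a vertex of the cell of [q] can be redirected to its other vertex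
    at the cost of [ends_dist]. This is the triangle inequality for paths that
    finish at a vertex. *)
Lemma arc_to_end p q l v : arc p q l -> v \in ends q ->
  exists2 u, u \in ends p & u.2 + (word_dist A u.1 v.1)%:R <= l + v.2.
Proof.
case=> [|/vertex_arcP[u [v' [up v'q hl]]] vq]; last first.
  exists u => //; have := ends_dist v'q vq.
  have := word_dist_triangle hA u.1 v'.1 v.1.
  by rewrite -(ler_nat R) natrD; lra.
case: p q => [//|g a t aA ht] [//|h b s bA hs] /= [] [-> -> ->]; rewrite !inE.
  case/orP => /eqP -> /=.
    exists (g, t); rewrite ?inE ?eqxx //= word_dist0 // addr0.
    by have := ler_norm (t - s); lra.
  exists ((g * a)%g, 1 - t); rewrite ?inE ?eqxx ?orbT //= word_dist0 // addr0.
  by have := ler_norm (s - t); rewrite distrC; lra.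
case/orP => /eqP -> /=.
  exists ((g * a)%g, 1 - t); rewrite ?inE ?eqxx ?orbT //= word_dist0 // addr0.
  by have := ler_norm (- (t - (1 - s))); rewrite normrN; lra.
exists (g, t); rewrite ?inE ?eqxx //= mulgK word_dist0 // addr0.
by have := ler_norm (t - (1 - s)); lra.
Qed.

Lemma arc_ends_dist p q l u v : arc p q l -> u \in ends p -> v \in ends q ->
  (word_dist A u.1 v.1)%:R <= u.2 + l + v.2.
Proof.
move=> pql up /(arc_to_end pql)[u' u'p hu'].
have := ends_dist up u'p; have := ends_ge0 u'p.
have := word_dist_triangle hA u.1 u'.1 v.1.
by rewrite -(ler_nat R) natrD; lra.
Qed.

(** The summand 1 is a margin that spares showing that the infimum defining
    the path metric is attained. *)
Lemma cayley_dist_vertices_near (p q : cayley R A) u v (e : R) :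
  cayley_dist p q <= e -> u \in ends p -> v \in ends q ->
  (word_dist A u.1 v.1)%:R <= u.2 + v.2 + e + 1.
Proof.
move=> pqe up vq; have [|l le pql] := @cayley_dist_lt p q (e + 1); first lra.
by have := arc_ends_dist pql up vq; lra.
Qed.

Section WordGeodesic.
Variables (g : G) (w : seq G).
Hypothesis gw : geodesic_word A w.
Local Notation n := (size w).
Local Notation pv := (path_vertex g w).

(** The point at time [t] of the unit speed path from [g] labelled by [w]. It
    is a relation because an edge point carries proofs. The choice of the edge
    whose starting vertex is the integral part of [t] leaves a single edge for
    each time, the end of the path being named as a vertex. *)
Definition at_time (t : R) p : Prop :=
  (exists k (aA : nth 1%g w k \in A) (ht : 0 <= t - k%:R <= 1),
     [/\ (k < n)%N, t < k.+1%:R &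
         p = Edge (pv k) (nth 1%g w k) (t - k%:R) aA ht])
  \/ (t = n%:R /\ p = Vertex (pv n)).

Lemma at_time_exists t : 0 <= t <= n%:R -> exists p, at_time t p.
Proof.
case/andP=> t0; rewrite le_eqVlt => /orP[/eqP ->|tn].
  by exists (Vertex (pv n)); right.
have /andP[k1 k2] := truncn_itv t0.
set k := Num.trunc t in k1 k2.
have kn : (k < n)%N by rewrite -(ltr_nat R) (le_lt_trans k1).
have aA : nth 1%g w k \in A by apply: gw.1; rewrite mem_nth.
have ht : 0 <= t - k%:R <= 1 by rewrite -natr1 in k2; lra.
by eexists; left; exists k, aA, ht; split.
Qed.

Lemma at_time_ends t p : at_time t p -> forall u, u \in ends p ->
  exists2 k, (k <= n)%N & u.1 = pv k /\ u.2 = `|t - k%:R|.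
Proof.
case=> [[k [aA [ht [kn tk ->]]]]|[-> ->]] u /=; rewrite !inE.
  case/orP=> /eqP -> /=.
    by exists k; [exact: ltnW|rewrite ger0_norm //; lra].
  exists k.+1 => //; rewrite path_vertexS //; split=> //.
  by rewrite -natr1 ler0_norm; lra.
by move/eqP=> ->; exists n => //=; rewrite subrr normr0.
Qed.

Lemma path_vertex_dist i j : (i <= n)%N -> (j <= n)%N ->
  (word_dist A (pv i) (pv j))%:R = `|i%:R - j%:R| :> R.
Proof.
move=> iw jw; have gv := geodesic_path_vertex hA g gw.
wlog ij : i j iw jw / (i <= j)%N.
  move=> H; have [ij|/ltnW ji] := leqP i j; first exact: H.
  by rewrite word_distC // H // distrC.
by rewrite gv ?ij // distrC natrB // ger0_norm // subr_ge0 ler_nat.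
Qed.

(** Positions along the path can be compared at the ends of the two cells. An
    arc inside a common edge is not a shortcut either, because distinct times
    have distinct vertices: the same edge cannot occur twice, nor be traversed
    backwards. *)
Lemma at_time_dist_ge s t p q : at_time s p -> at_time t q ->
  `|s - t| <= cayley_dist p q.
Proof.
move=> sp tq; apply: le_cayley_dist => l [|/vertex_arcP[u [v [up vq]]]].
  case: sp => [[k [aA [hs [kn sk ->]]]]|[_ ->] //].
  case: tq => [[k' [aA' [ht [kn' tk ->]]]]|[_ ->] //] /=.
  have inj i j : (i <= n)%N -> (j <= n)%N -> pv i = pv j -> i = j.
    move=> iw jw e; have := path_vertex_dist iw jw.
    rewrite e word_dist0 // => /esym/eqP.
    by rewrite normr_eq0 subr_eq0 eqr_nat; move/eqP.
  case=> -[e1 e2 ->].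
    have -> : k' = k by apply: inj; rewrite // ltnW.
    by rewrite le_eqVlt; apply/orP; left; apply/eqP; congr `|_|; lra.
  rewrite -path_vertexS // in e1.
  have kk : k' = k.+1 by apply: inj; rewrite // ltnW.
  have e3 : pv k'.+1 = pv k.
    by rewrite path_vertexS // e1 e2 path_vertexS // mulgK.
  have := inj _ _ kn' (ltnW kn) e3; lia.
apply: le_trans.
have [i iw [-> ->]] := at_time_ends sp up.
have [j jw [-> ->]] := at_time_ends tq vq.
rewrite path_vertex_dist //.
have := ler_distD i%:R s t; have := ler_distD j%:R i%:R t.
by rewrite (distrC t j%:R); lra.
Qed.

Lemma at_time_dist_le s t p q : s <= t -> at_time s p -> at_time t q ->
  cayley_dist p q <= t - s.
Proof.
move=> st sp tq.
case: sp => [[k [aA [hs [kn sk ->]]]]|[es ->]]; last first.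
  case: tq => [[k [aA [ht [kn tk _]]]]|[et ->]].
    have : k.+1%:R <= n%:R :> R by rewrite ler_nat.
    by lra.
  have -> : t - s = 0 + (word_dist A (pv n) (pv n))%:R + 0.
    by rewrite word_dist0 //; lra.
  by apply: cayley_dist_le; apply: (@vertex_arc_ends _ _ (_, 0) (_, 0));
     rewrite inE.
(* from an edge, a later cell is reached through the final vertex of the edge *)
have far j v q' : (k < j)%N -> (j <= n)%N -> v \in ends q' -> v.1 = pv j ->
    v.2 = t - j%:R ->
    cayley_dist (Edge (pv k) (nth 1%g w k) (s - k%:R) aA hs) q' <= t - s.
  move=> kj jw vq v1 v2.
  have -> : t - s = (1 - (s - k%:R)) +
      (word_dist A (pv k * nth 1%g w k)%g v.1)%:R + v.2.
    rewrite -path_vertexS // v1 path_vertex_dist // distrC.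
    rewrite ger0_norm ?subr_ge0 ?ler_nat // v2 -natr1; lra.
  apply: cayley_dist_le.
  apply: (@vertex_arc_ends _ _ ((pv k * nth 1%g w k)%g, 1 - (s - k%:R))) => //.
  by rewrite /= !inE eqxx orbT.
case: tq => [[k' [aA' [ht [kn' tk ->]]]]|[et ->]]; last first.
  by apply: (far n (pv n, 0)) => //=; rewrite ?inE //; lra.
have kk' : (k <= k')%N.
  by rewrite -ltnS -(ltr_nat R); lra.
have [kk|] := eqVneq k k'; last first.
  move=> ne; apply: (far k' (pv k', t - k'%:R)); rewrite //= ?inE ?eqxx //.
    by rewrite ltn_neqAle ne.
  exact: ltnW.
subst k'; apply: cayley_dist_le; left; left; split=> //.
by rewrite distrC ger0_norm; lra.
Qed.

Lemma geodesic_word_geodesic : exists2 c : R -> cayley R A,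
  geodesic (Vertex g) (Vertex (pv n)) n%:R c &
  forall t, 0 <= t <= n%:R -> at_time t (c t).
Proof.
have ex (t : R) : exists p, 0 <= t <= n%:R -> at_time t p.
  have [/at_time_exists[p hp]|h] := boolP (0 <= t <= n%:R); first by exists p.
  by exists (Vertex g).
have [c hc] := choice ex; exists c => //.
have n0 : 0 <= n%:R :> R by [].
have zero p x : (x, 0) \in ends p -> cayley_dist p (Vertex x) = 0.
  move=> xp; apply/le_anti/andP; split; last first.
    by apply: le_cayley_dist => l; exact: arc_ge0.
  have -> : 0 = 0 + (word_dist A x x)%:R + 0 :> R.
    by rewrite word_dist0 // !addr0.
  by apply: cayley_dist_le; apply: (@vertex_arc_ends _ _ (x, 0) (x, 0));
    rewrite ?inE.
split=> //.
- apply: zero; have := hc 0; rewrite lexx n0 => /(_ isT).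
  case=> [[k [aA [ht [kn tk ->]]]]|[e ->]] /=; last first.
    have /eqP : n%:R = 0 :> R by [].
    by rewrite pnatr_eq0 => /eqP ->; rewrite path_vertex0 inE.
  have k0 : k = 0%N.
    have : k%:R <= 0 :> R by lra.
    by rewrite (ler_nat R _ 0) leqn0; move/eqP.
  by subst k; rewrite path_vertex0 subr0 inE eqxx.
- apply: zero; have := hc n%:R; rewrite lexx n0 => /(_ isT).
  case=> [[k [aA [ht [kn tk ->]]]]|[e ->]] /=; last by rewrite inE.
  by move: tk; rewrite ltr_nat; lia.
- move=> s t hs ht; apply/le_anti/andP; split; last first.
    by apply: at_time_dist_ge; exact: hc.
  have [st|/ltW ts] := leP s t.
    rewrite distrC ger0_norm ?subr_ge0 //.
    by apply: at_time_dist_le => //; exact: hc.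
  rewrite cayley_distC ger0_norm ?subr_ge0 //.
  by apply: at_time_dist_le => //; exact: hc.
Qed.

Lemma at_time_near t p : at_time t p -> exists2 u, u \in ends p &
  u.2 <= 1 /\ exists2 k, (k <= n)%N & u.1 = pv k.
Proof.
case=> [[k [aA [ht [kn tk ->]]]]|[_ ->]] /=.
  exists (pv k, t - k%:R); rewrite ?inE ?eqxx //=.
  split; first by case/andP: ht.
  by exists k => //; exact: ltnW.
by exists (pv n, 0); rewrite ?inE //=; split=> //; exists n.
Qed.

Lemma at_time_nat k p : (k <= n)%N -> at_time k%:R p -> (pv k, 0) \in ends p.
Proof.
move=> kn [[i [aA [ht [ilt tk ->]]]]|[e ->]] /=; last first.
  by move/eqP: e; rewrite eqr_nat => /eqP ->; rewrite inE.
have ki : (i <= k)%N by rewrite -(ler_nat R); lra.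
have -> : k = i by move: tk; rewrite ltr_nat; lia.
by rewrite subrr inE eqxx.
Qed.
End WordGeodesic.

Lemma btw_on_geodesic (x p y : G) : btw (word_dist A) x p y ->
  exists c : R -> cayley R A, exists2 t,
   0 <= t <= (word_dist A x y)%:R &
   geodesic (Vertex x) (Vertex y) (word_dist A x y)%:R c /\
   (p, 0) \in ends (c t).
Proof.
move=> /(btw_geodesic_word hA)[w [gw ey pw ep]].
have sz : word_dist A x y = size w.
  by rewrite -ey path_vertex_size word_dist_mulr gw.2.
have [c gc hc] := geodesic_word_geodesic x gw; rewrite ey in gc.
have ht : 0 <= ((word_dist A x p)%:R : R) <= (size w)%:R.
  by rewrite ler0n ler_nat.
exists c, (word_dist A x p)%:R; rewrite sz //; split=> //.
by have := at_time_nat pw (hc _ ht); rewrite ep.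
Qed.

Lemma geodesic_with_btw_points x y :
  exists c : R -> cayley R A,
   geodesic (Vertex x) (Vertex y) (word_dist A x y)%:R c /\
   forall t, 0 <= t <= (word_dist A x y)%:R -> exists2 u, u \in ends (c t) &
   u.2 <= 1 /\ btw (word_dist A) x u.1 y.
Proof.
have [w gw ey] := geodesic_word_between hA x y.
have sz : word_dist A x y = size w by rewrite -ey word_dist_mulr gw.2.
have [c gc hc] := geodesic_word_geodesic x gw.
rewrite path_vertex_size ey in gc.
exists c; rewrite sz; split=> // t /hc/at_time_near[u uc [u1 [k kn ek]]].
exists u => //; split=> //; rewrite ek -ey -path_vertex_size.
rewrite -{1}(path_vertex0 x w).
by apply: geodesic_seq_btw kn; exact: geodesic_path_vertex.
Qed.

(** Let [t] be the time of the point. It has an end [u] through which [x] is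
    reached in about [t], and an end [v] through which [y] is reached in about
    [l - t]. The two ends are at most [u.2 + v.2] apart, so the route from [x]
    through [u] and [v] to [y] has length less than [d x y + 1]; being an
    integer, its length is [d x y]. *)
Lemma geodesic_vertex_near x y l (c : R -> cayley R A) t :
  geodesic (Vertex x) (Vertex y) l c -> 0 <= t <= l ->
  exists2 u, u \in ends (c t) & btw (word_dist A) x u.1 y.
Proof.
case=> l0 cx cy gc tl.
have h0 : 0 <= (0 : R) <= l by rewrite lexx.
have hl : 0 <= l <= l by rewrite lexx andbT.
(* the end points of [c] are only names of [x] and [y], possibly edge points;
   the margins of 1/8 add up to less than 1 *)
have near z s : cayley_dist (c s) (Vertex z) = 0 ->
    exists2 o, o < 8%:R^-1 & (z, o) \in ends (c s).
  move=> e; have [|r r8 arz] := @cayley_dist_lt (c s) (Vertex z) 8%:R^-1.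
    by rewrite e; lra.
  have [u uc] := arc_to_end arz (v := (z, 0)) ltac:(by rewrite inE) .
  rewrite /= addr0 => hu; have u0 := ends_ge0 uc.
  have uz : word_dist A u.1 z = 0%N.
    have : (word_dist A u.1 z)%:R < 1%:R :> R by lra.
    by rewrite ltr_nat; lia.
  exists u.2; first by rewrite uz in hu; lra.
  have [w [_ lw] ez] := geodesic_word_between hA u.1 z.
  have w0 : size w = 0%N by rewrite -lw -(word_dist_mulr _ u.1) ez.
  move: ez; rewrite (size0nil w0) big_nil mulg1 => <-.
  by rewrite -surjective_pairing.
have [o1 o1s xc] := near _ _ cx; have [o2 o2s yc] := near _ _ cy.
have [u uc hu] : exists2 u, u \in ends (c t) &
    u.2 + (word_dist A u.1 x)%:R < t + 4%:R^-1.
  have [|r rlt ar] := @cayley_dist_lt (c t) (c 0) (t + 8%:R^-1).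
    by rewrite gc // subr0 ger0_norm; lra.
  by have [u uc /= hu] := arc_to_end ar xc; exists u => //; lra.
have [v vc hv] : exists2 v, v \in ends (c t) &
    v.2 + (word_dist A v.1 y)%:R < l - t + 4%:R^-1.
  have [|r rlt ar] := @cayley_dist_lt (c t) (c l) (l - t + 8%:R^-1).
    by rewrite gc // distrC ger0_norm; lra.
  by have [v vc /= hv] := arc_to_end ar yc; exists v => //; lra.
have ll : l <= o1 + (word_dist A x y)%:R + o2.
  have -> : l = cayley_dist (c 0) (c l) by rewrite gc // sub0r normrN ger0_norm.
  by apply: cayley_dist_le; exact: (vertex_arc_ends xc yc).
have uv := ends_dist uc vc.
have tot : (word_dist A u.1 x + word_dist A u.1 v.1 + word_dist A v.1 y
              <= word_dist A x y)%N.
  rewrite -ltnS -(ltr_nat R) -natr1 !natrD; lra.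
exists u => //; rewrite /btw.
rewrite (word_distC hA u.1 x) in tot.
have t1 := word_dist_triangle hA u.1 v.1 y.
have t2 := word_dist_triangle hA x u.1 y.
by clear -hA tot t1 t2; lia.
Qed.

Lemma nat_bound (e : R) :
  exists N : nat, forall m : nat, m%:R <= e -> (m <= N)%N.
Proof.
exists (Num.trunc e) => m me.
by rewrite truncn_ge_nat // (le_trans _ me).
Qed.

(** A vertex of an interval is placed on a real geodesic, and a point close to
    it on another side is replaced by an end of its cell; rounding costs a
    constant. *)
Lemma thin_of_slim (delta : R) :
  slim_triangles A delta -> exists delta', thin (word_dist A) delta'.
Proof.
move=> slim; have [N hN] := nat_bound (delta + 2).
exists N => x y z p /btw_on_geodesic[c1 [t ht [gc1 pc1]]].
have [c2 [gc2 hc2]] := geodesic_with_btw_points y z.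
have [c3 [gc3 hc3]] := geodesic_with_btw_points z x.
have near (s : R) (c : R -> cayley R A) (q1 q2 : G) :
    cayley_dist (c1 t) (c s) <= delta ->
    (exists2 u, u \in ends (c s) & u.2 <= 1 /\ btw (word_dist A) q1 u.1 q2) ->
    exists2 q, btw (word_dist A) q1 q q2 & (word_dist A p q <= N)%N.
  move=> near [u uc [u1 bu]]; exists u.1 => //; apply: hN.
  by have /= := cayley_dist_vertices_near near pc1 uc; lra.
case: (slim _ _ _ _ _ _ _ _ _ gc1 gc2 gc3 t ht) => -[s hs cs].
  by have [q bq pq] := near _ _ _ _ cs (hc2 _ hs); exists q => //; left.
by have [q bq pq] := near _ _ _ _ cs (hc3 _ hs); exists q => //; right.
Qed.

Lemma quasiconvex_word_quasiconvex (S : set G) :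
  quasiconvex R A S <-> exists N, word_quasiconvex A S N.
Proof.
split=> [[e _ qc]|[N qc]].
  have [N hN] := nat_bound (e + 1).
  exists N => x y Sx Sy p /btw_on_geodesic[c [t ht [gc pc]]].
  have [q Sq cq] := qc _ _ _ _ Sx Sy gc t ht; exists q => //; apply: hN.
  have qe : (q, 0) \in ends (Vertex q : cayley R A) by rewrite inE.
  by have /= := cayley_dist_vertices_near cq pc qe; lra.
exists (N%:R + 1) => [|x y l c Sx Sy gc t ht]; first by rewrite addr_ge0.
have [u uc bu] := geodesic_vertex_near gc ht.
have [q Sq uq] := qc _ _ Sx Sy _ bu; exists q => //.
apply: (@le_trans _ _ (u.2 + (word_dist A u.1 q)%:R + 0)).
  apply: cayley_dist_le.
  by apply: (@vertex_arc_ends _ _ u (q, 0)); rewrite ?inE.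
have : (word_dist A u.1 q)%:R <= N%:R :> R by rewrite ler_nat.
suff : u.2 <= 1 by lra.
move: uc; case: (c t) => [h|h a s aA hs]; rewrite /= !inE.
  by move/eqP => ->.
by case/orP => /eqP -> /=; lra.
Qed.
End CayleyArcs.

(** * Quasiconvex products *)

Theorem corollary1 (R : realType) (G : groupType) (A : seq G) (Q : set G) :
  hyperbolic_group R G -> sym_gen_set A ->
  quasiconvex_product R A Q -> quasiconvex R A Q.
Proof.
move=> [B hB [delta _ slimB]] hA [n [f [H [_ qcH ->]]]].
have [delta0 thinB] := thin_of_slim hB slimB.
have [K1 hK1] := word_length_lipschitz hA hB.
have [K2 hK2] := word_length_lipschitz hB hA.
have [delta1 thinA] : exists delta', thin (word_dist A) delta'.
  have BA x y : (word_dist B x y <= (K1 + K2) * word_dist A x y)%N.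
    by apply: leq_trans (hK1 _) _; rewrite leq_mul2r leq_addr orbT.
  have AB x y : (word_dist A x y <= (K1 + K2) * word_dist B x y)%N.
    by apply: leq_trans (hK2 _) _; rewrite leq_mul2r leq_addl orbT.
  exact: thin_bilipschitz (word_dist_graph_metric hB)
    (word_dist_graph_metric hA) BA AB thinB.
apply/(quasiconvex_word_quasiconvex R hA).
apply: (word_quasiconvex_prod hA thinA f
  (H := fun i => [set g | g \in H i]%classic)).
by move=> i; apply/(quasiconvex_word_quasiconvex R hA).
Qed.
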